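(* Let $\lambda\in\mathbb{R}$, let $r\ge 0$ be an integer and let $p$ be a positive integer. Then for all real $x$ with $|x|<1$, \[ \frac{1}{r!}\Big(\frac{d}{dx}\Big)^r\bigg[\frac{x^r}{(1-x)^2}F_{p,\lambda}\Big(\frac{x}{1-x}\Big)\bigg]-\Big(x\frac{d}{dx}\Big)_{p,\lambda}\Big(\frac{1}{1-x}\Big)^{r+1}=\sum_{k=1}^{\infty}(k)_{p,\lambda}\bigg(\frac{1}{(1-x)^{r+1}}-\sum_{j=0}^{k}\binom{r+j}{j}x^j\bigg). \]
   Context: For $\lambda\in\mathbb{R}$, the generalized falling factorials are $(x)_{0,\lambda}=1$ and $(x)_{n,\lambda}=x(x-\lambda)(x-2\lambda)\cdots(x-(n-1)\lambda)$ for $n\ge 1$. The degenerate differential operator is $\big(x\frac{d}{dx}\big)_{n,\lambda}=\big(x\frac{d}{dx}\big)\big(x\frac{d}{dx}-\lambda\big)\cdots\big(x\frac{d}{dx}-(n-1)\lambda\big)$ for $n\ge1$. The degenerate exponential is the formal power series $e_\lambda(t)=\sum_{n\ge 0}(1)_{n,\lambda}\frac{t^n}{n!}$. The degenerate Fubini polynomials $F_{n,\lambda}(x)$ are defined by $\frac{1}{1-x(e_\lambda(t)-1)}=\sum_{n=0}^{\infty}F_{n,\lambda}(x)\frac{t^n}{n!}$ (as formal power series in $t$). *)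

(* Defs.v *)
(* Stdlib reals with Coquelicot. A formal power series in t is represented by
   its coefficient sequence [nat -> R], as for Coquelicot's [PS_plus],
   [PS_mult], etc.; no convergence is involved. *)
From Stdlib Require Import Reals Factorial Lra Lia.
From Coquelicot Require Import Coquelicot.
Open Scope R_scope.

Fixpoint gen_falling (lam x : R) (n : nat) : R :=
  match n with
  | O => 1
  | S m => gen_falling lam x m * (x - INR m * lam)
  end.

Definition xD (f : R -> R) : R -> R := fun x => x * Derive f x.

(* Operator product: the rightmost factor (xD - (n-1) lam) acts first. *)
Fixpoint degen_xD (lam : R) (n : nat) (f : R -> R) : R -> R :=
  match n with
  | O => f
  | S m => degen_xD lam m (fun x => xD f x - INR m * lam * f x)
  end.

Definition PS_one : nat -> R := fun n => match n with O => 1 | S _ => 0 end.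

(* [PS_inv_upto a n] agrees with the coefficients of 1/a at all indices <= n;
   it solves a_0 b_(m+1) + sum_(i <= m) a_(i+1) b_(m-i) = 0. *)
Fixpoint PS_inv_upto (a : nat -> R) (n : nat) : nat -> R :=
  match n with
  | O => fun _ => / a O
  | S m => fun k =>
      if Nat.leb k m then PS_inv_upto a m k
      else - / a O * sum_f_R0 (fun i => a (S i) * PS_inv_upto a m (m - i)%nat) m
  end.

(* Multiplicative inverse of a formal power series with nonzero constant
   coefficient. *)
Definition PS_inv (a : nat -> R) : nat -> R := fun n => PS_inv_upto a n n.

Lemma PS_inv_upto_le (a : nat -> R) (n k : nat) :
  (k <= n)%nat -> PS_inv_upto a n k = PS_inv a k.
Proof.
  induction n as [|n IH]; intros Hk.
  - now replace k with O by lia.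
  - destruct (Nat.eq_dec k (S n)) as [->|Hne]; [reflexivity|].
    simpl. destruct (Nat.leb_spec k n) as [Hle|Hlt]; [now apply IH | lia].
Qed.

Lemma PS_mult_inv (a : nat -> R) (n : nat) :
  a O <> 0 -> PS_mult a (PS_inv a) n = PS_one n.
Proof.
  intros Ha. destruct n as [|m]; unfold PS_mult.
  - simpl. unfold PS_inv; simpl. now field.
  - rewrite decomp_sum by lia. simpl Init.Nat.pred.
    rewrite Nat.sub_0_r. unfold PS_inv at 1. cbn [PS_inv_upto].
    rewrite (proj2 (Nat.leb_gt (S m) m)) by lia.
    rewrite (sum_eq (fun i => a (S i) * PS_inv a (S m - S i)%nat)
                    (fun i => a (S i) * PS_inv_upto a m (m - i)%nat)).
    + change (PS_one (S m)) with 0. now field.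
    + intros i Hi. rewrite PS_inv_upto_le by lia. reflexivity.
Qed.

Definition degen_exp (lam : R) : nat -> R :=
  fun n => gen_falling lam 1 n / INR (fact n).

Definition fubini_denom (lam x : R) : nat -> R :=
  PS_minus PS_one (PS_scal x (PS_minus (degen_exp lam) PS_one)).

Definition degen_fubini (lam : R) (n : nat) (x : R) : R :=
  INR (fact n) * PS_inv (fubini_denom lam x) n.

Lemma degen_fubini_generating (lam x : R) (n : nat) :
  PS_mult (fubini_denom lam x)
          (fun m => degen_fubini lam m x / INR (fact m)) n = PS_one n.
Proof.
  rewrite <- (PS_mult_inv (fubini_denom lam x)).
  - unfold PS_mult. apply sum_eq. intros i _. f_equal.
    unfold degen_fubini. field. apply INR_fact_neq_0.
  - unfold fubini_denom, degen_exp, PS_minus, PS_scal, PS_plus, PS_opp.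
    simpl. unfold plus, opp, scal; simpl. unfold mult; simpl. lra.
Qed.

(* Main.v *)
(* Write [a_j = C(r+j,j)] and [S_k = (1)_p + ... + (k)_p]. The generating function
   of [(k)_p] is [F_p(x/(1-x)) / (1-x)], so that of [S_k] is
   [F_p(x/(1-x)) / (1-x)^2], and [D^r (x^r .) / r!] multiplies the k-th
   coefficient by [a_k]; the left-hand side is therefore
   [sum_j a_j (S_j - (j)_p) x^j = sum_j a_j S_(j-1) x^j]. The right-hand side is
   [sum_k (k)_p sum_(j > k) a_j x^j], and summation by parts identifies the two. *)
Require Import Defs.
From Stdlib Require Import Reals Factorial Lra Lia Arith.
From Coquelicot Require Import Coquelicot.
Open Scope R_scope.

(** * Finite sums, falling factorials and formal inverses *)

Lemma sum_f_R0_const_mult (c : R) (f : nat -> R) (n : nat) :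
  sum_f_R0 (fun i => c * f i) n = c * sum_f_R0 f n.
Proof. induction n as [|n IH]; simpl; rewrite ?IH; ring. Qed.

Lemma gen_falling_0 (lam : R) (n : nat) : (0 < n)%nat -> gen_falling lam 0 n = 0.
Proof.
  induction n as [|n IH]; [lia|]; intros _.
  destruct n as [|n]; [simpl; ring|].
  change (gen_falling lam 0 (S n) * (0 - INR (S n) * lam) = 0).
  rewrite IH by lia. ring.
Qed.

(** Coefficient of t^n in the power e_lambda(t)^x; at x = 1 it is [degen_exp lam n]. *)
Definition falling_div (lam : R) (n : nat) (x : R) : R :=
  gen_falling lam x n / INR (fact n).

Lemma falling_div_S (lam : R) (n : nat) (x : R) :
  INR (S n) * falling_div lam (S n) x = falling_div lam n x * (x - INR n * lam).
Proof.
  unfold falling_div. rewrite fact_simpl, mult_INR. cbn [gen_falling].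
  field. split; [apply INR_fact_neq_0 | apply not_0_INR; lia].
Qed.

(* Both sides satisfy [(n+1) w_(n+1) = (x + y - n lam) w_n]. *)
Lemma falling_div_vandermonde (lam x y : R) (n : nat) :
  sum_f_R0 (fun i => falling_div lam i x * falling_div lam (n - i) y) n
  = falling_div lam n (x + y).
Proof.
  induction n as [|n IH].
  - unfold falling_div; simpl. field.
  - apply Rmult_eq_reg_l with (INR (S n)); [|apply not_0_INR; lia].
    rewrite falling_div_S, <- IH, <- sum_f_R0_const_mult.
    (* The factor n+1 is split as i + (n+1-i); each half lowers one index through
       [falling_div_S]. *)
    rewrite (sum_eq _ (fun i =>
        (INR i * falling_div lam i x) * falling_div lam (S n - i) y
        + falling_div lam i x * (INR (S n - i) * falling_div lam (S n - i) y))).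
    2:{ intros i Hi. rewrite (minus_INR (S n) i) by lia. ring. }
    rewrite sum_plus, decomp_sum by lia. simpl Nat.pred.
    change (INR 0) with 0. rewrite tech5, Nat.sub_diag. change (INR 0) with 0.
    rewrite (Rmult_comm (sum_f_R0 _ n) (x + y - _)), <- sum_f_R0_const_mult.
    (* The boundary terms, i = 0 of the first sum and i = n+1 of the second, carry a factor 0. *)
    match goal with |- (0 * ?a * ?b + ?A) + (?B + ?c * (0 * ?d)) = ?C =>
      transitivity (A + B); [ring|] end.
    rewrite <- sum_plus. apply sum_eq. intros i Hi.
    rewrite falling_div_S. replace (S n - i)%nat with (S (n - i)) by lia.
    rewrite falling_div_S. simpl Nat.sub. rewrite minus_INR by lia. ring.
Qed.

(** With [a O] invertible, the n-th equation determines [b n] from the earlier coefficients; hence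
    strong induction. *)
Lemma PS_inv_unique (a b : nat -> R) :
  a O <> 0 -> (forall n, PS_mult a b n = PS_one n) -> forall n, b n = PS_inv a n.
Proof.
  intros Ha Hb n. induction n as [n IH] using lt_wf_ind.
  pose proof (Hb n) as H1. pose proof (PS_mult_inv a n Ha) as H2.
  rewrite <- H2 in H1. unfold PS_mult in H1. destruct n as [|n].
  - simpl in H1. now apply Rmult_eq_reg_l with (a O).
  - rewrite !(decomp_sum _ (S n)) in H1 by lia.
    rewrite (sum_eq (fun i => a (S i) * b (S n - S i)%nat)
                    (fun i => a (S i) * PS_inv a (S n - S i)%nat)) in H1.
    + apply Rmult_eq_reg_l with (a O); [|exact Ha].
      rewrite Nat.sub_0_r in H1. lra.
    + intros i Hi. rewrite IH by lia. reflexivity.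
Qed.

(** * Power series on the open unit disc *)

Definition expands (a : nat -> R) (f : R -> R) : Prop :=
  forall x, Rabs x < 1 -> is_pseries a x (f x).

(** The series converges at a point y strictly between |x| and 1, so its terms tend to 0 there,
    which excludes a radius below y. *)
Lemma expands_radius (a : nat -> R) (f : R -> R) (x : R) :
  expands a f -> Rabs x < 1 -> Rbar_lt (Rabs x) (CV_radius a).
Proof.
  intros Hf Hx. set (y := (Rabs x + 1) / 2).
  assert (Hy : Rabs y = y) by (apply Rabs_pos_eq; pose proof (Rabs_pos x); unfold y; lra).
  apply Rbar_lt_le_trans with y; [unfold y; simpl; lra|].
  apply Rbar_not_lt_le. intros Hlt. rewrite <- Hy in Hlt.
  apply (CV_disk_outside a y Hlt), ex_series_lim_0.
  exists (f y). apply is_pseries_R, Hf. unfold y in *; lra.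
Qed.

Lemma expands_PSeries (a : nat -> R) (f : R -> R) (x : R) :
  expands a f -> Rabs x < 1 -> PSeries a x = f x.
Proof. intros Hf Hx. apply is_pseries_unique, Hf, Hx. Qed.

Lemma expands_ext (a b : nat -> R) (f g : R -> R) :
  (forall k, a k = b k) -> (forall x, Rabs x < 1 -> f x = g x) ->
  expands a f -> expands b g.
Proof.
  intros Hab Hfg Hf x Hx. rewrite <- Hfg by exact Hx.
  now apply is_pseries_ext with a; [|apply Hf].
Qed.

(** Lets a function be replaced by its power series under a derivative, which is local. *)
Lemma locally_unit_disc (P : R -> Prop) (x : R) :
  (forall y, Rabs y < 1 -> P y) -> Rabs x < 1 -> locally x P.
Proof.
  intros HP Hx. assert (He : 0 < 1 - Rabs x) by lra.
  exists (mkposreal _ He). intros y Hy. apply HP.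
  change (Rabs (y - x) < 1 - Rabs x) in Hy.
  pose proof (Rabs_triang_inv y x). lra.
Qed.

Lemma expands_xD (a : nat -> R) (f : R -> R) :
  expands a f -> expands (fun k => INR k * a k) (xD f).
Proof.
  intros Hf x Hx. unfold xD.
  rewrite (Derive_ext_loc f (PSeries a)).
  2:{ apply locally_unit_disc; [|exact Hx]. intros y Hy.
      symmetry. now apply expands_PSeries. }
  apply is_pseries_ext with (PS_incr_1 (PS_derive a)).
  - intros [|k]; [simpl; unfold zero; simpl; ring | reflexivity].
  - apply (is_pseries_incr_1 _ x (Derive (PSeries a) x)).
    apply is_pseries_derive. now apply expands_radius with f.
Qed.

(** Each x^k is an eigenfunction of [xD] with eigenvalue k, so the factors of the operator act on
    coefficients as k - m lam. The induction varies [a] and [f] because the last factor acts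
    first. *)
Lemma expands_degen_xD (lam : R) (p : nat) (a : nat -> R) (f : R -> R) :
  expands a f ->
  expands (fun k => gen_falling lam (INR k) p * a k) (degen_xD lam p f).
Proof.
  revert a f. induction p as [|p IH]; intros a f Hf.
  - apply expands_ext with a f; trivial. intros k; simpl; ring.
  - simpl. apply expands_ext with
      (fun k => gen_falling lam (INR k) p * ((INR k - INR p * lam) * a k))
      (degen_xD lam p (fun x => xD f x - INR p * lam * f x)); trivial.
    { intros k; ring. }
    apply IH. intros x Hx. apply is_pseries_R.
    apply is_series_ext with
      (fun k => minus (INR k * a k * x ^ k) (scal (INR p * lam) (a k * x ^ k))).
    { intros k. unfold minus, plus, opp, scal; simpl. unfold mult; simpl. ring. }
    apply (is_series_minus _ _ (xD f x)).
    + apply is_pseries_R. now apply (expands_xD a f).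
    + apply (is_series_scal (INR p * lam) _ (f x)), is_pseries_R. now apply Hf.
Qed.

Lemma expands_geom : expands (fun _ => 1) (fun x => 1 / (1 - x)).
Proof.
  intros x Hx. apply is_pseries_R.
  apply is_series_ext with (fun k => x ^ k); [intros k; symmetry; apply Rmult_1_l|].
  unfold Rdiv. rewrite Rmult_1_l. now apply is_series_geom.
Qed.

(** Cauchy product with the geometric series. *)
Lemma expands_partial_sums (a : nat -> R) (f : R -> R) :
  expands a f -> expands (sum_f_R0 a) (fun x => f x * (1 / (1 - x))).
Proof.
  intros Hf x Hx. apply is_pseries_ext with (PS_mult a (fun _ => 1)).
  - intros n. unfold PS_mult. apply sum_eq. intros; ring.
  - apply is_pseries_mult.
    + now apply Hf.
    + now apply expands_geom.
    + now apply expands_radius with f.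
    + apply expands_radius with (2 := Hx) (1 := expands_geom).
Qed.

(** Convergence inside the disc is absolute. The new sum has no closed form in general, so [PSeries]
    names it. *)
Lemma expands_abs (a : nat -> R) (f : R -> R) :
  expands a f -> expands (fun k => Rabs (a k)) (PSeries (fun k => Rabs (a k))).
Proof.
  intros Hf x Hx. apply PSeries_correct, CV_radius_inside.
  assert (Habs : forall y, 0 <= y < 1 -> ex_pseries (fun k => Rabs (a k)) y).
  { intros y Hy. apply ex_pseries_R.
    apply ex_series_ext with (fun k => Rabs (a k * y ^ k)).
    - intros k. rewrite Rabs_mult, (Rabs_pos_eq (y ^ k)); [reflexivity|].
      apply pow_le; lra.
    - apply CV_disk_inside, expands_radius with f; [exact Hf|].
      rewrite Rabs_pos_eq; lra. }
  set (y := (Rabs x + 1) / 2). pose proof (Rabs_pos x).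
  assert (Hy : Rabs y = y) by (apply Rabs_pos_eq; unfold y; lra).
  apply Rbar_lt_le_trans with y; [unfold y; simpl; lra|].
  apply Rbar_not_lt_le. intros Hlt. rewrite <- Hy in Hlt.
  apply (CV_disk_outside _ y Hlt), ex_series_lim_0, ex_pseries_R, Habs.
  unfold y; lra.
Qed.

(** * Binomial weights and Newton's series *)

(** Hockey-stick identity, by Pascal's rule. *)
Lemma binom_diag_S (r n : nat) :
  Binomial.C (S r + n) n = sum_f_R0 (fun j => Binomial.C (r + j) j) n.
Proof.
  induction n as [|n IH].
  - cbn [sum_f_R0]. unfold Binomial.C. rewrite !Nat.sub_0_r.
    field. repeat split; apply INR_fact_neq_0.
  - rewrite tech5, <- IH.
    replace (S r + S n)%nat with (S (S r + n)) by lia.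
    rewrite <- pascal by lia. f_equal. f_equal; lia.
Qed.

(** By the hockey-stick identity, raising r by one takes partial sums, i.e. multiplies by
    1/(1-x). *)
Lemma expands_newton (r : nat) :
  expands (fun j => Binomial.C (r + j) j) (fun x => 1 / (1 - x) ^ (r + 1)).
Proof.
  induction r as [|r IH].
  - apply expands_ext with (3 := expands_geom).
    + intros k. unfold Binomial.C. simpl. rewrite Nat.sub_diag. simpl.
      field. apply INR_fact_neq_0.
    + intros x Hx. simpl. now rewrite Rmult_1_r.
  - apply expands_ext with (3 := expands_partial_sums _ _ IH).
    + intros n. now rewrite binom_diag_S.
    + intros x Hx. apply Rabs_def2 in Hx. simpl. field.
      split; [apply pow_nonzero|]; lra.
Qed.

(** The r-th derivative sends x^(r+k) to ((r+k)!/k!) x^k, and division by r! leaves C(r+k,k). *)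
Lemma expands_binom (r : nat) (b : nat -> R) (f : R -> R) :
  expands b f ->
  expands (fun k => Binomial.C (r + k) k * b k)
    (fun x => 1 / INR (fact r) * Derive_n (fun y => y ^ r * f y) r x).
Proof.
  intros Hf.
  assert (Hs : expands (PS_incr_n b r) (fun y => y ^ r * f y)).
  { intros y Hy. rewrite <- pow_n_pow. apply (is_pseries_incr_n b r y (f y)). now apply Hf. }
  intros x Hx.
  rewrite (Derive_n_ext_loc _ (PSeries (PS_incr_n b r))).
  2:{ apply locally_unit_disc; [|exact Hx]. intros y Hy.
      symmetry. now apply (expands_PSeries _ _ y Hs). }
  pose proof (expands_radius _ _ x Hs Hx) as Hr.
  rewrite Derive_n_PSeries by exact Hr.
  apply is_pseries_ext with (PS_scal (1 / INR (fact r)) (PS_derive_n r (PS_incr_n b r))).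
  - intros k. unfold PS_scal, PS_derive_n. rewrite PS_incr_n_simplify.
    destruct (Compare_dec.le_lt_dec r (k + r)) as [_|H]; [|lia].
    replace (k + r - r)%nat with k by lia. unfold Binomial.C.
    replace (r + k - k)%nat with r by lia. rewrite (Nat.add_comm r k).
    unfold scal; simpl; unfold mult; simpl. field. split; apply INR_fact_neq_0.
  - apply (is_pseries_scal (1 / INR (fact r)) _ x (PSeries (PS_derive_n r (PS_incr_n b r)) x)).
    + apply Rmult_comm.
    + apply PSeries_correct, CV_radius_inside. now rewrite CV_radius_derive_n.
Qed.

(** * Generating function of the falling factorials *)

Lemma is_pseries_sum_f_R0 (b : nat -> nat -> R) (l : nat -> R) (x : R) (n : nat) :
  (forall i, is_pseries (b i) x (l i)) ->
  is_pseries (fun k => sum_f_R0 (fun i => b i k) n) x (sum_f_R0 l n).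
Proof.
  intros H. induction n as [|n IH]; simpl; [apply H|].
  apply (is_pseries_plus _ (b (S n)) x (sum_f_R0 l n) (l (S n))); [exact IH|apply H].
Qed.

(* With [y = x/(1-x)] one has [1/(1 - y(e-1)) = (1-x)/(1 - x e)
   = (1-x) sum_k x^k e^k], and [e^k] has coefficients [(k)_n/n!]; the inverse is
   verified coefficientwise, by Vandermonde applied to [(1+k)_n]. *)
Lemma expands_fubini (lam : R) (p : nat) :
  expands (fun k => gen_falling lam (INR k) p)
    (fun x => 1 / (1 - x) * degen_fubini lam p (x / (1 - x))).
Proof.
  assert (Hg : forall n, expands (fun k => gen_falling lam (INR k) n)
                           (degen_xD lam n (fun x => 1 / (1 - x)))).
  { intros n. apply expands_ext with (3 := expands_degen_xD lam n _ _ expands_geom); trivial.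
    intros; ring. }
  intros x Hx. assert (Hx1 : 1 - x <> 0) by (apply Rabs_def2 in Hx; lra).
  (* [c n] is the coefficient of t^n in G = sum_k x^k e_lambda(t)^k. *)
  set (c := fun n => PSeries (fun k => falling_div lam n (INR k)) x).
  assert (Hc : forall n, is_pseries (fun k => falling_div lam n (INR k)) x (c n)).
  { intros n. apply PSeries_correct.
    apply ex_pseries_ext with (PS_scal (/ INR (fact n)) (fun k => gen_falling lam (INR k) n)).
    - intros k. unfold PS_scal, falling_div, scal; simpl. unfold mult; simpl.
      unfold Rdiv. ring.
    - apply ex_pseries_scal; [apply Rmult_comm|]. eexists. now apply Hg. }
  (* Coefficient form of G = 1 + x e G: the term k = 0 is split off and the others are shifted by
     one. *)
  assert (Hconv : forall n, c n = PS_one n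
            + x * sum_f_R0 (fun i => degen_exp lam i * c (n - i)%nat) n).
  { intros n. unfold c at 1. rewrite PSeries_decr_1 by (eexists; apply Hc).
    f_equal.
    - unfold falling_div. destruct n as [|n]; [simpl; field|].
      change (INR 0) with 0. rewrite gen_falling_0 by lia. simpl; unfold Rdiv; ring.
    - f_equal. apply is_pseries_unique.
      apply is_pseries_ext with
        (fun k => sum_f_R0 (fun i => degen_exp lam i * falling_div lam (n - i) (INR k)) n).
      + intros k. unfold PS_decr_1. rewrite S_INR, Rplus_comm.
        apply falling_div_vandermonde.
      + apply (is_pseries_sum_f_R0
                 (fun i k => degen_exp lam i * falling_div lam (n - i) (INR k))).
        intros i. apply (is_pseries_scal (degen_exp lam i) _ x (c (n - i)%nat)).
        * apply Rmult_comm.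
        * apply Hc. }
  (* Clearing denominators: (1-x)(1 - y(e-1)) = 1 - x e. *)
  assert (Hd : forall i, (1 - x) * fubini_denom lam (x / (1 - x)) i
                         = PS_one i - x * degen_exp lam i).
  { intros i. unfold fubini_denom, PS_minus, PS_scal, PS_plus, PS_opp.
    unfold plus, opp, scal; simpl. unfold mult; simpl. field. exact Hx1. }
  assert (Hinv : forall n, (1 - x) * c n = PS_inv (fubini_denom lam (x / (1 - x))) n).
  { apply (PS_inv_unique (fubini_denom lam (x / (1 - x))) (fun n => (1 - x) * c n)).
    (* A zero constant coefficient would turn [Hd] at 0 into 0 = 1 - x. *)
    - intros H0. pose proof (Hd O) as H1. rewrite H0 in H1.
      unfold degen_exp in H1; simpl in H1. lra.
    - intros n. unfold PS_mult.
      rewrite (sum_eq _ (fun i => PS_one i * c (n - i)%nat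
                 + (- x) * (degen_exp lam i * c (n - i)%nat))).
      2:{ intros i _. transitivity ((1 - x) * fubini_denom lam (x / (1 - x)) i * c (n - i)%nat);
          [ring|]. rewrite Hd. ring. }
      rewrite sum_plus, sum_f_R0_const_mult.
      assert (Hone : sum_f_R0 (fun i => PS_one i * c (n - i)%nat) n = c n).
      { destruct n as [|n]; [simpl; ring|].
        rewrite decomp_sum by lia. rewrite (sum_eq _ (fun _ => 0)).
        - rewrite sum_cte. simpl. ring.
        - intros i _. simpl. ring. }
      rewrite Hone, Hconv. ring. }
  (* The series already sums to the operator applied to 1/(1-x); only the closed form of that value
     is left. *)
  replace (1 / (1 - x) * degen_fubini lam p (x / (1 - x)))
    with (degen_xD lam p (fun x => 1 / (1 - x)) x); [now apply Hg|].
  unfold degen_fubini. rewrite <- Hinv.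
  transitivity (INR (fact p) * c p); [|now field].
  rewrite <- (expands_PSeries _ _ x (Hg p) Hx). unfold c.
  rewrite <- PSeries_scal. apply PSeries_ext. intros k.
  unfold PS_scal, falling_div, scal; simpl. unfold mult; simpl.
  field. apply INR_fact_neq_0.
Qed.

(** * Summation by parts for series of tails *)

Lemma is_series_lim_seq (a : nat -> R) (l : R) :
  is_series a l <-> is_lim_seq (sum_f_R0 a) l.
Proof.
  split; intros H.
  - apply is_lim_seq_ext with (sum_n a); [intros n; apply sum_n_Reals | exact H].
  - change (is_lim_seq (sum_n a) l).
    apply is_lim_seq_ext with (sum_f_R0 a); [|exact H].
    intros n; symmetry; apply sum_n_Reals.
Qed.

(** As [w] is nondecreasing, w_n times the tail of b after n is at most the tail of sum_k w_k |b_k|,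
    which tends to 0. *)
Lemma weighted_tail_lim (w b : nat -> R) (l : R) :
  (forall n, 0 <= w n <= w (S n)) -> is_series b l ->
  ex_series (fun n => w n * Rabs (b n)) ->
  is_lim_seq (fun n => w n * Rabs (l - sum_f_R0 b n)) 0.
Proof.
  intros Hw Hb [W HW].
  assert (Hmono : forall n m, (n <= m)%nat -> w n <= w m).
  { intros n m H. induction H; [lra|]. destruct (Hw m); lra. }
  set (s := sum_f_R0 (fun n => w n * Rabs (b n))).
  assert (Hs : is_lim_seq s W) by now apply is_series_lim_seq.
  (* Finite form of the bound; letting m grow gives it for the whole tail. *)
  assert (Hfin : forall n m, w n * Rabs (sum_f_R0 b (n + m) - sum_f_R0 b n)
                             <= s (n + m)%nat - s n).
  { intros n m. induction m as [|m IH].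
    - rewrite Nat.add_0_r. unfold Rminus. rewrite !Rplus_opp_r, Rabs_R0. lra.
    - rewrite Nat.add_succ_r. unfold s in *. rewrite !tech5.
      assert (w n * Rabs (b (S (n + m))) <= w (S (n + m)) * Rabs (b (S (n + m)))).
      { apply Rmult_le_compat_r; [apply Rabs_pos|apply Hmono; lia]. }
      pose proof (Rabs_triang (sum_f_R0 b (n + m) - sum_f_R0 b n) (b (S (n + m)))) as Ht.
      replace (sum_f_R0 b (n + m) + b (S (n + m)) - sum_f_R0 b n)
        with (sum_f_R0 b (n + m) - sum_f_R0 b n + b (S (n + m))) by ring.
      apply (Rmult_le_compat_l (w n)) in Ht; [|apply Hw]. lra. }
  apply is_lim_seq_le_le with (fun _ => 0) (fun n => W - s n).
  - intros n. split; [apply Rmult_le_pos; [apply Hw|apply Rabs_pos]|].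
    apply (is_lim_seq_le (fun m => w n * Rabs (sum_f_R0 b (n + m) - sum_f_R0 b n))
             (fun m => s (n + m)%nat - s n)
             (w n * Rabs (l - sum_f_R0 b n)) (W - s n)).
    + apply Hfin.
    + apply (is_lim_seq_scal_l _ (w n) (Rabs (l - sum_f_R0 b n))).
      apply (is_lim_seq_abs _ (l - sum_f_R0 b n)).
      apply is_lim_seq_minus'; [|apply is_lim_seq_const].
      apply is_lim_seq_ext with (fun m => sum_f_R0 b (m + n)).
      { intros m. now rewrite Nat.add_comm. }
      apply (is_lim_seq_incr_n (sum_f_R0 b) n l).
      now apply is_series_lim_seq.
    + apply is_lim_seq_minus'; [|apply is_lim_seq_const].
      apply is_lim_seq_ext with (fun m => s (m + n)%nat).
      { intros m. now rewrite Nat.add_comm. }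
      now apply (is_lim_seq_incr_n s n W).
  - apply is_lim_seq_const.
  - replace (Finite 0) with (Finite (W - W)) by (f_equal; ring).
    apply is_lim_seq_minus'; [apply is_lim_seq_const|exact Hs].
Qed.

(* Summation by parts: the boundary term [V n (l - B n)] is controlled by the
   partial sums of [|v|], which are nondecreasing whereas [|V|] need not be. *)
Lemma is_series_tails (v b : nat -> R) (l L : R) :
  is_series b l ->
  ex_series (fun n => sum_f_R0 (fun k => Rabs (v k)) n * Rabs (b n)) ->
  is_series (fun n => (sum_f_R0 v n - v n) * b n) L ->
  is_series (fun n => v n * (l - sum_f_R0 b n)) L.
Proof.
  intros Hb Habs HL.
  assert (Hparts : forall n, sum_f_R0 (fun n => v n * (l - sum_f_R0 b n)) n
            = sum_f_R0 v n * (l - sum_f_R0 b n)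
              + sum_f_R0 (fun n => (sum_f_R0 v n - v n) * b n) n).
  { induction n as [|n IH]; [simpl; ring|]. rewrite !tech5, IH. ring. }
  assert (H0 : is_lim_seq (fun n => sum_f_R0 v n * (l - sum_f_R0 b n)) 0).
  { apply is_lim_seq_abs_0.
    apply is_lim_seq_le_le with (fun _ => 0)
      (fun n => sum_f_R0 (fun k => Rabs (v k)) n * Rabs (l - sum_f_R0 b n)).
    - intros n. split; [apply Rabs_pos|]. rewrite Rabs_mult.
      apply Rmult_le_compat_r; [apply Rabs_pos|apply Rsum_abs].
    - apply is_lim_seq_const.
    - apply weighted_tail_lim; trivial. intros n. split.
      + apply cond_pos_sum. intros; apply Rabs_pos.
      + rewrite tech5. pose proof (Rabs_pos (v (S n))). lra. }
  apply is_series_lim_seq.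
  apply is_lim_seq_ext with (fun n => sum_f_R0 v n * (l - sum_f_R0 b n)
              + sum_f_R0 (fun n => (sum_f_R0 v n - v n) * b n) n).
  { intros n. now rewrite Hparts. }
  rewrite <- (Rplus_0_l L). apply is_lim_seq_plus'; [exact H0|].
  now apply is_series_lim_seq.
Qed.

Theorem theorem12 (lam : R) (r p : nat) (hp : (0 < p)%nat)
    (x : R) (hx : Rabs x < 1) :
  is_series
    (fun i : nat => let k := S i in
       gen_falling lam (INR k) p *
       (1 / (1 - x) ^ (r + 1)
        - sum_f_R0 (fun j => Binomial.C (r + j) j * x ^ j) k))
    (1 / INR (fact r) *
       Derive_n (fun y => y ^ r / (1 - y) ^ 2 * degen_fubini lam p (y / (1 - y))) r x
     - degen_xD lam p (fun y => (1 / (1 - y)) ^ (r + 1)) x).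
Proof.
  set (v := fun k => gen_falling lam (INR k) p).
  set (b := fun j => Binomial.C (r + j) j * x ^ j).
  assert (Hv0 : v O = 0) by (apply gen_falling_0; exact hp).
  assert (Hnewton : expands (fun j => Binomial.C (r + j) j)
                      (fun y => (1 / (1 - y)) ^ (r + 1))).
  { apply expands_ext with (3 := expands_newton r); trivial.
    intros y Hy. unfold Rdiv. rewrite !Rmult_1_l. now rewrite pow_inv. }
  pose proof (expands_partial_sums _ _ (expands_fubini lam p)) as HS.
  assert (Hbinom : expands (fun k => Binomial.C (r + k) k * sum_f_R0 v k)
     (fun y => 1 / INR (fact r) *
        Derive_n (fun y => y ^ r / (1 - y) ^ 2 * degen_fubini lam p (y / (1 - y))) r y)).
  { apply expands_ext with (3 := expands_binom r _ _ HS); trivial.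
    (* The two forms of the differentiated function are compared on the disc only, where 1 - z is
       nonzero; this suffices by locality. *)
    intros y Hy. f_equal. apply Derive_n_ext_loc, locally_unit_disc; [|exact Hy].
    intros z Hz. apply Rabs_def2 in Hz. field. lra. }
  match goal with |- is_series _ ?l => set (L := l) end.
  (* Since (0)_p = 0 for p > 0, the term k = 0 may be added to the series, which the statement
     starts at k = 1. *)
  apply (is_series_incr_1 (fun k => v k * (1 / (1 - x) ^ (r + 1) - sum_f_R0 b k))).
  match goal with |- is_series _ ?l => replace l with L end.
  2:{ symmetry. rewrite Hv0, Rmult_0_l. apply Rplus_0_r. }
  apply is_series_tails.
  - apply is_pseries_R. now apply (expands_newton r).
  (* Absolute values, partial sums and binomial factors each keep convergence on the disc; the
     result is evaluated at |x|. *)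
  - pose proof (expands_abs _ _ (expands_binom r _ _
      (expands_partial_sums _ _ (expands_abs _ _ (expands_fubini lam p))))) as HA.
    apply ex_series_ext with
      (fun k => Rabs (Binomial.C (r + k) k * sum_f_R0 (fun k => Rabs (v k)) k) * Rabs x ^ k).
    + intros k. unfold b. rewrite !Rabs_mult, RPow_abs.
      rewrite (Rabs_pos_eq (sum_f_R0 _ k)).
      * simpl. ring.
      * apply cond_pos_sum. intros; apply Rabs_pos.
    + apply ex_pseries_R. eexists. apply HA. now rewrite Rabs_Rabsolu.
  (* The terms (S_k - v_k) a_k x^k split into those of the derivative and those of the operator on
     the left-hand side. *)
  - apply is_series_ext with (fun k => minus (Binomial.C (r + k) k * sum_f_R0 v k * x ^ k)
                                         (v k * Binomial.C (r + k) k * x ^ k)).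
    { intros k. unfold minus, plus, opp, b; simpl. ring. }
    apply (is_series_minus _ _ (1 / INR (fact r) *
       Derive_n (fun y => y ^ r / (1 - y) ^ 2 * degen_fubini lam p (y / (1 - y))) r x)).
    + apply is_pseries_R. now apply Hbinom.
    + apply is_pseries_R. now apply (expands_degen_xD lam p _ _ Hnewton).
Qed.
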